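(* Let $k\ge 1$ be an integer. There exist constants $C=C_k>0$ and $\alpha=\alpha_k>0$, depending only on $k$, such that the following holds. Let $\mu$ be a probability measure on a measurable space $(X,\mathcal X)$, let $n\ge1$, let $\xi_1,\dots,\xi_n$ be independent $X$-valued random variables with distribution $\mu$, and let $f=f(x_1,\dots,x_k)$ be a (measurable) canonical function on $(X^k,\mathcal X^k,\mu^k)$ such that $$\|f\|_\infty=\sup_{x_j\in X,\;1\le j\le k}|f(x_1,\dots,x_k)|\le 1$$ and $$\|f\|_2^2=\int f^2(x_1,\dots,x_k)\,\mu(dx_1)\dots\mu(dx_k)\le\sigma^2$$ with some $\sigma>0$. Then the $U$-statistic $I_{n,k}(f)$ satisfies $$P\left(n^{-k/2}|I_{n,k}(f)|>x\right)\le C\max\left(\exp\left\{-\alpha\left(\frac x\sigma\right)^{2/k}\right\},\ \exp\left\{-\alpha (nx^2)^{1/(k+1)}\right\}\right)\quad\text{for all }x>0.$$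
   Context: For i.i.d. $X$-valued random variables $\xi_1,\dots,\xi_n$ with distribution $\mu$ and a function $f$ of $k$ variables, the $U$-statistic is $$I_{n,k}(f)=\frac1{k!}\sum_{\substack{1\le j_s\le n,\ s=1,\dots,k\\ j_s\ne j_{s'}\text{ if }s\ne s'}} f(\xi_{j_1},\dots,\xi_{j_k}).$$ A real-valued function $f=f(x_1,\dots,x_k)$ on $(X^k,\mathcal X^k)$ (not necessarily symmetric) is called canonical with respect to $\mu$ if $$\int f(x_1,\dots,x_{j-1},u,x_{j+1},\dots,x_k)\,\mu(du)=0\quad\text{for all }1\le j\le k\text{ and all }x_s\in X,\ s\ne j.$$ *)

(* Defs.v *)
From HB Require Import structures.
From mathcomp Require Import all_boot all_order all_algebra.
From mathcomp Require Import all_classical all_reals all_analysis.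

Set Implicit Arguments.
Unset Strict Implicit.
Unset Printing Implicit Defensive.

Import Order.TTheory GRing.Theory Num.Theory.
Import numFieldNormedType.Exports.

Local Open Scope classical_set_scope.
Local Open Scope ring_scope.

(* A function of k variables on a measurable space X is a function on
   [k.-tuple X], whose sigma-algebra is generated by the k coordinate maps. *)

Section power_probability.
Context {d : measure_display} {X : measurableType d} {R : realType}.

Definition cons_pair (n : nat) (p : X * n.-tuple X) : n.+1.-tuple X :=
  [the n.+1.-tuple X of p.1 :: p.2].

Lemma measurable_cons_pair (n : nat) :
  measurable_fun [set: X * n.-tuple X] (@cons_pair n).
Proof. exact: (measurable_cons measurable_fst measurable_snd). Qed.

HB.instance Definition _ (n : nat) :=
  isMeasurableFun.Build _ _ _ _ (@cons_pair n) (@measurable_cons_pair n).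

Fixpoint power_probability (mu : probability X R) (n : nat) :
    probability (n.-tuple X) R :=
  match n return probability (n.-tuple X) R with
  | 0 => \d_([tuple])
  | m.+1 => distribution (mu \x power_probability mu m)%E (@cons_pair m)
  end.

Lemma power_probability_box (mu : probability X R) (n : nat)
    (A : 'I_n -> set X) : (forall i, measurable (A i)) ->
  power_probability mu n [set x | forall i, A i (tnth x i)] =
  (\prod_(i < n) mu (A i))%E.
Proof.
elim: n A => [|n IHn] A mA.
  by rewrite big_ord0 /= diracE mem_set// => -[].
rewrite big_ord_recl -IHn//= /distribution /pushforward.
rewrite -[RHS]product_measure1E//; last first.
  rewrite (_ : mkset _ =
    \bigcap_(i in [set: 'I_n]) (fun x => tnth x i) @^-1` A (lift ord0 i)).
    apply: fin_bigcap_measurable => // i _.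
    by rewrite -[X in measurable X]setTI; exact: measurable_tnth.
  by apply/seteqP; split => x /= h i; [move=> _|]; exact: h.
congr (product_measure1 _ _ _); apply/seteqP; split => -[x t] /=.
  move=> h; split => /=; first exact: (h ord0).
  by move=> i; have := h (lift ord0 i); rewrite tnthS.
move=> [/= h0 h] i; case: (unliftP ord0 i) => [j ->|->]; last exact: h0.
by rewrite tnthS; exact: h.
Qed.

End power_probability.

Section u_statistics.
Context {d : measure_display} {X : measurableType d} {R : realType}.

Definition subst_coord (k : nat) (x : k.-tuple X) (j : 'I_k) (u : X) :
    k.-tuple X :=
  [tuple if i == j then u else tnth x i | i < k].

(* The integral is extended-real valued, and oo - oo = -oo in \bar R: for a
   measurable f the equation also says that u |-> f (.., u, ..) is integrable. *)
Definition canonical_fun (mu : probability X R) (k : nat) (f : k.-tuple X -> R) :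
    Prop :=
  forall (j : 'I_k) (x : k.-tuple X),
    (\int[mu]_u (f (subst_coord x j u))%:E = 0)%E.

Definition sup_norm (T : Type) (f : T -> R) : \bar R :=
  ereal_sup (range (fun x => `|f x|%:E)).

Definition U_statistic (n k : nat) (f : k.-tuple X -> R) (xi : 'I_n -> X) : R :=
  (k`!%:R)^-1 *
  \sum_(j : {ffun 'I_k -> 'I_n} | injectiveb j) f [tuple xi (j s) | s < k].

End u_statistics.

Definition mutually_independent (d d' : measure_display)
    (Omega : measurableType d') (X : measurableType d) (R : realType)
    (P : probability Omega R) (I : finType) (xi : I -> {RV P >-> X}) : Prop :=
  forall (J : {set I}) (A : I -> set X),
    (forall i, i \in J -> measurable (A i)) ->
    P (\bigcap_(i in [set` J]) (xi i @^-1` A i)) =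
    (\prod_(i in J) P (xi i @^-1` A i))%E.

(* Main.v *)
(* For an even exponent p = 2M, expand the p-th moment of the sum
   T = sum_j f(xi_{j_1}, .., xi_{j_k}) over injective j into expectations of
   products f_1 .. f_p of copies of f.  By canonicity a product has zero mean as
   soon as some index is used by exactly one copy.  Otherwise, if r distinct
   indices are used, discarding at most kp - 2r copies (each bounded by 1) leaves
   every index in at most two of the remaining ones, and Cauchy-Schwarz, applied
   one coordinate at a time, bounds the mean by ||f||_2^(p - (kp - 2r)).  There
   are at most 'C(n, r) r^(kp) such products, whence, up to constants depending
   on k,
     E T^(2M) <= n^(kM) (A M^k max(M/n, ||f||_2^2))^M
   (for 2M > n this already follows from |T| <= n^k).  Apply Markov's inequality
   with M the integer part of alpha min((x/sigma)^(2/k), (n x^2)^(1/(k+1))): then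
   A M^k max(M/n, sigma^2) is at most x^2/e. *)

From HB Require Import structures.
Require Import Defs.
From mathcomp Require Import all_boot all_order all_algebra.
From mathcomp Require Import all_classical all_reals all_analysis.
From mathcomp Require Import measurable_realfun.
From mathcomp Require Import zify ring lra.

Set Implicit Arguments.
Unset Strict Implicit.
Unset Printing Implicit Defensive.

Import Order.TTheory GRing.Theory Num.Theory.
Import numFieldNormedType.Exports.

Local Open Scope classical_set_scope.
Local Open Scope ring_scope.

(** * Bounded measurable functions and their real-valued integrals *)

Definition bounded_measurable d (T : measurableType d) (R : realType)
    (f : T -> R) : Prop :=
  measurable_fun [set: T] f /\ exists M, forall x, `|f x| <= M.

Section bounded_measurable.
Context {d : measure_display} {T : measurableType d} {R : realType}.
Implicit Types (f g : T -> R) (mu : probability T R).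

Lemma bounded_measurable_cst (c : R) : bounded_measurable (fun _ : T => c).
Proof. by split; [exact: measurable_cst | exists `|c|]. Qed.

Lemma bounded_measurableD f g : bounded_measurable f -> bounded_measurable g ->
  bounded_measurable (fun x => f x + g x).
Proof.
move=> [mf [M fM]] [mg [N gN]]; split; first exact: measurable_funD.
by exists (M + N) => x; apply: le_trans (ler_normD _ _) _; exact: lerD.
Qed.

Lemma bounded_measurableM f g : bounded_measurable f -> bounded_measurable g ->
  bounded_measurable (fun x => f x * g x).
Proof.
move=> [mf [M fM]] [mg [N gN]]; split; first exact: measurable_funM.
by exists (M * N) => x; rewrite normrM ler_pM.
Qed.

Lemma bounded_measurableZ (c : R) f : bounded_measurable f ->
  bounded_measurable (fun x => c * f x).
Proof. exact: (bounded_measurableM (bounded_measurable_cst c)). Qed.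

Lemma bounded_measurable_norm f : bounded_measurable f ->
  bounded_measurable (fun x => `|f x|).
Proof.
move=> [mf [M fM]]; split; first exact: measurableT_comp.
by exists M => x; rewrite normr_id.
Qed.

Lemma bounded_measurable_sqrt f : bounded_measurable f ->
  bounded_measurable (fun x => Num.sqrt (f x)).
Proof.
move=> [mf [M fM]]; split.
  apply: (measurableT_comp _ mf); apply: continuous_measurable_fun.
  exact: sqrt_continuous.
exists (Num.sqrt M) => x.
by rewrite ger0_norm ?sqrtr_ge0// ler_wsqrtr// (le_trans (ler_norm _)).
Qed.

Lemma bounded_measurable_sum (I : Type) (r : seq I) (P : pred I)
    (F : I -> T -> R) : (forall i, bounded_measurable (F i)) ->
  bounded_measurable (fun x => \sum_(i <- r | P i) F i x).
Proof.
move=> bF; elim: r => [|i r IHr].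
  under [X in bounded_measurable X]eq_fun do rewrite big_nil.
  exact: bounded_measurable_cst.
under [X in bounded_measurable X]eq_fun do rewrite big_cons.
by case: (P i) => //; exact: bounded_measurableD.
Qed.

Lemma bounded_measurable_prod (I : Type) (r : seq I) (P : pred I)
    (F : I -> T -> R) : (forall i, bounded_measurable (F i)) ->
  bounded_measurable (fun x => \prod_(i <- r | P i) F i x).
Proof.
move=> bF; elim: r => [|i r IHr].
  under [X in bounded_measurable X]eq_fun do rewrite big_nil.
  exact: bounded_measurable_cst.
under [X in bounded_measurable X]eq_fun do rewrite big_cons.
by case: (P i) => //; exact: bounded_measurableM.
Qed.

Lemma bounded_measurable_comp d' (T' : measurableType d') (h : T' -> T) f :
  measurable_fun [set: T'] h -> bounded_measurable f ->
  bounded_measurable (fun x => f (h x)).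
Proof.
move=> mh [mf [M fM]]; split; first exact: (measurableT_comp mf mh).
by exists M.
Qed.

Lemma bounded_measurable_exp f m : bounded_measurable f ->
  bounded_measurable (fun x => f x ^+ m).
Proof.
move=> bf; elim: m => [|m IHm]; first exact: bounded_measurable_cst.
under [X in bounded_measurable X]eq_fun do rewrite exprS.
exact: bounded_measurableM.
Qed.

(** The purpose of the class: on a probability space its members are integrable, and it is stable
    under sums, products, square roots, sections and partial integrals, so the integrability side
    conditions below reduce to it. *)
Lemma bounded_measurable_integrable mu f : bounded_measurable f ->
  mu.-integrable [set: T] (EFin \o f).
Proof.
move=> [mf [M fM]]; apply: measurable_bounded_integrable => //.
  by rewrite -ge0_fin_numE// fin_num_measure.
by exists M; split; [exact: num_real | move=> N MN x _; exact: le_trans (ltW MN)].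
Qed.

Lemma bounded_measurable_EFin mu f : bounded_measurable f ->
  (\int[mu]_x f x)%:E = (\int[mu]_x (f x)%:E)%E.
Proof.
move=> bf; rewrite /Rintegral fineK//; apply: integrable_fin_num => //.
exact: bounded_measurable_integrable.
Qed.

Lemma Rintegral_sum_bounded mu (I : Type) (r : seq I) (P : pred I)
    (F : I -> T -> R) : (forall i, bounded_measurable (F i)) ->
  \int[mu]_x (\sum_(i <- r | P i) F i x) = \sum_(i <- r | P i) \int[mu]_x F i x.
Proof.
move=> bF; elim: r => [|i r IHr].
  under eq_Rintegral do rewrite big_nil.
  by rewrite Rintegral_cst// mul0r big_nil.
under eq_Rintegral do rewrite big_cons.
rewrite big_cons; case: (P i) => //; rewrite -IHr RintegralD//.
  exact: bounded_measurable_integrable.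
exact/bounded_measurable_integrable/bounded_measurable_sum.
Qed.

Lemma Rintegral_prob_cst mu (c : R) : \int[mu]_x c = c.
Proof.
rewrite Rintegral_cst//.
by rewrite (_ : _ [set: T] = 1%E) ?mulr1//; exact: probability_setT.
Qed.

Lemma le_Rintegral_bounded mu f g : bounded_measurable f ->
  bounded_measurable g -> (forall x, f x <= g x) ->
  \int[mu]_x f x <= \int[mu]_x g x.
Proof.
by move=> bf bg fg; apply: le_Rintegral => // ; exact: bounded_measurable_integrable.
Qed.

(** The quadratic [t |-> a + 2tc + t^2 b], being the integral of [(f + t g)^2], is nonnegative for
    every [t]. *)
Lemma Rintegral_cauchy_schwarz mu f g :
  bounded_measurable f -> bounded_measurable g ->
  \int[mu]_x (f x * g x) <=
  Num.sqrt (\int[mu]_x f x ^+ 2) * Num.sqrt (\int[mu]_x g x ^+ 2).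
Proof.
move=> bf bg.
set a := \int[mu]_x f x ^+ 2; set b := \int[mu]_x g x ^+ 2.
set c := \int[mu]_x _.
have a0 : 0 <= a by apply: Rintegral_ge0 => x _; exact: sqr_ge0.
have b0 : 0 <= b by apply: Rintegral_ge0 => x _; exact: sqr_ge0.
have quad t : 0 <= a + t * c *+ 2 + t ^+ 2 * b.
  have : 0 <= \int[mu]_x (f x + t * g x) ^+ 2.
    by apply: Rintegral_ge0 => x _; exact: sqr_ge0.
  rewrite (_ : \int[mu]_x _ = \int[mu]_x (f x ^+ 2 + t * 2 * (f x * g x) +
    t ^+ 2 * g x ^+ 2)); last by apply: eq_Rintegral => x _; ring.
  have bfg := bounded_measurableM bf bg.
  rewrite !RintegralD//; try by
    repeat first [apply: bounded_measurable_integrable |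
      apply: bounded_measurableD | apply: bounded_measurableZ |
      apply: bounded_measurable_exp | assumption].
  rewrite !RintegralZl//; try by
    repeat first [apply: bounded_measurable_integrable |
      apply: bounded_measurable_exp | assumption].
  by rewrite -/a -/b -/c => h; rewrite (le_trans h)//; lra.
have [c0|c0] := leP c 0; first by rewrite (le_trans c0)// mulr_ge0 ?sqrtr_ge0.
rewrite -sqrtrM// -[leLHS]ger0_norm ?(ltW c0)// -sqrtr_sqr ler_wsqrtr//.
(* For [b = 0] the quadratic is affine with slope [2c > 0], and this [t] would give it the value
   -1. *)
have [b_0|b_neq0] := eqVneq b 0.
  have := quad (- ((a + 1) / (2 * c))); rewrite b_0 mulr0 addr0.
  rewrite (_ : - _ * c *+ 2 = - (a + 1)); first lra.
  by field; rewrite gt_eqF.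
have b_gt0 : 0 < b by rewrite lt_neqAle eq_sym b_neq0.
(* The minimiser of the quadratic. *)
have := quad (- (c / b)).
rewrite (_ : _ + _ = a - c ^+ 2 / b); last by field; rewrite gt_eqF.
by rewrite subr_ge0 ler_pdivrMr.
Qed.

End bounded_measurable.

(** * Fubini's theorem for bounded measurable functions *)

Section fubini.
Context d1 d2 (X : measurableType d1) (Y : measurableType d2) (R : realType).
Variables (mu : probability X R) (nu : probability Y R) (F : X * Y -> R).
Hypothesis bF : bounded_measurable F.

Lemma bounded_measurable_pair1 x : bounded_measurable (fun y => F (x, y)).
Proof. exact: bounded_measurable_comp bF. Qed.

Lemma bounded_measurable_pair2 y : bounded_measurable (fun x => F (x, y)).
Proof. exact: bounded_measurable_comp bF. Qed.

Let iF : (mu \x nu)%E.-integrable [set: X * Y] (EFin \o F).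
Proof. exact: bounded_measurable_integrable. Qed.

Lemma bounded_measurable_Rintegral :
  bounded_measurable (fun x => \int[nu]_y F (x, y)).
Proof.
split.
  apply: measurableT_comp; first exact: fine_measurable.
  exact: (measurable_fubini_F iF).
have [_ [M FM]] := bF; exists M => x.
have bFx := bounded_measurable_pair1 x.
apply: (le_trans (le_normr_Rintegral _ _)) => //.
  exact: bounded_measurable_integrable.
rewrite -[leRHS](Rintegral_prob_cst nu); apply: le_Rintegral_bounded => //.
  exact: bounded_measurable_norm.
exact: bounded_measurable_cst.
Qed.

Lemma Rintegral12_prod :
  \int[mu]_x \int[nu]_y F (x, y) = \int[(mu \x nu)%E]_z F z.
Proof.
rewrite /Rintegral -(integral12_prod_meas1 iF); congr fine.
apply: eq_integral => x _.
exact: (bounded_measurable_EFin _ (bounded_measurable_pair1 x)).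
Qed.

Lemma Rintegral21_prod :
  \int[nu]_y \int[mu]_x F (x, y) = \int[(mu \x nu)%E]_z F z.
Proof.
rewrite /Rintegral -(integral21_prod_meas1 iF); congr fine.
apply: eq_integral => y _.
exact: (bounded_measurable_EFin _ (bounded_measurable_pair2 y)).
Qed.

End fubini.

(** * Integration over powers of [mu], one coordinate at a time *)

Section power_probability_integral.
Context d (X : measurableType d) (R : realType) (mu : probability X R).

Lemma bounded_measurable_cons n (F : n.+1.-tuple X -> R) :
  bounded_measurable F -> bounded_measurable (fun p => F (cons_pair p)).
Proof. by apply: bounded_measurable_comp; exact: measurable_cons_pair. Qed.

Lemma Rintegral_power0 (F : 0.-tuple X -> R) : bounded_measurable F ->
  \int[power_probability mu 0]_x F x = F [tuple].
Proof.
move=> [mF _]; rewrite /Rintegral /= integral_dirac//=.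
  by rewrite indicT mul1r.
exact/measurable_EFinP.
Qed.

Lemma Rintegral_powerS n (F : n.+1.-tuple X -> R) : bounded_measurable F ->
  \int[power_probability mu n.+1]_x F x =
  \int[mu]_x \int[power_probability mu n]_t F (cons_pair (x, t)).
Proof.
move=> bF; rewrite (Rintegral12_prod mu _ (bounded_measurable_cons bF)).
rewrite /Rintegral /= integral_distribution//.
  by have [mF _] := bF; exact/measurable_EFinP.
exact: bounded_measurable_integrable (bounded_measurable_cons bF).
Qed.

Lemma Rintegral_powerSC n (F : n.+1.-tuple X -> R) : bounded_measurable F ->
  \int[power_probability mu n.+1]_x F x =
  \int[power_probability mu n]_t \int[mu]_x F (cons_pair (x, t)).
Proof.
move=> bF; rewrite (Rintegral21_prod mu _ (bounded_measurable_cons bF)).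
by rewrite Rintegral_powerS// (Rintegral12_prod mu _ (bounded_measurable_cons bF)).
Qed.

Lemma cons_pair_subst_ord0 n x u (t : n.-tuple X) :
  subst_coord (cons_pair (x, t)) ord0 u = cons_pair (u, t).
Proof.
apply: eq_from_tnth => i; rewrite tnth_mktuple.
case: (unliftP ord0 i) => [j ->|->]; last by rewrite eqxx.
by rewrite eq_sym (negbTE (neq_lift _ _)) !tnthS.
Qed.

Lemma cons_pair_subst_lift n x u (t : n.-tuple X) j :
  subst_coord (cons_pair (x, t)) (lift ord0 j) u = cons_pair (x, subst_coord t j u).
Proof.
apply: eq_from_tnth => i; rewrite tnth_mktuple.
case: (unliftP ord0 i) => [l ->|->]; last by [].
by rewrite (inj_eq (@lift_inj _ ord0)) !tnthS tnth_mktuple.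
Qed.

(** Fubini lets the coordinate [v] be integrated first. The induction peels off the first
    coordinate: if it is [v], the order of integration is exchanged; otherwise the hypothesis passes
    to the sections. *)
Lemma Rintegral_power_eq0 n (F : n.-tuple X -> R) (v : 'I_n) :
  bounded_measurable F ->
  (forall x, \int[mu]_u F (subst_coord x v u) = 0) ->
  \int[power_probability mu n]_x F x = 0.
Proof.
elim: n F v => [F []//|n IHn] F v bF F0.
case: (unliftP ord0 v) F0 => [j ->|->] F0; last first.
  rewrite Rintegral_powerSC// -[RHS](Rintegral_prob_cst (power_probability mu n)).
  (* The hypothesis concerns full tuples, so some point of [X] must be put in front of [t]; over an
     empty [X] the section is vacuously zero. *)
  apply: eq_Rintegral => t _; have [[x]|noX] := pselect (inhabited X).
    by rewrite -[RHS](F0 (cons_pair (x, t))); apply: eq_Rintegral => u _;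
      rewrite cons_pair_subst_ord0.
  have -> : (fun x => F (cons_pair (x, t))) = fun=> 0.
    by apply/funext => x; exfalso; exact: noX.
  exact: Rintegral_prob_cst.
rewrite Rintegral_powerS// -[RHS](Rintegral_prob_cst mu).
apply: eq_Rintegral => x _; apply: (IHn _ j).
  exact: (bounded_measurable_pair1 (bounded_measurable_cons bF) x).
move=> t; rewrite -[RHS](F0 (cons_pair (x, t))); apply: eq_Rintegral => u _.
by rewrite cons_pair_subst_lift.
Qed.

End power_probability_integral.

(** * Uniqueness of the power measure, and the law of a subtuple *)

Section power_probability_law.
Context d (X : measurableType d) (R : realType) (mu : probability X R).

Definition box n (A : 'I_n -> set X) : set (n.-tuple X) :=
  [set x | forall i, A i (tnth x i)].

Lemma measurable_box n (A : 'I_n -> set X) :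
  (forall i, measurable (A i)) -> measurable (box A).
Proof.
move=> mA; rewrite (_ : box A =
    \bigcap_(i in [set: 'I_n]) (fun x => tnth x i) @^-1` A i).
  apply: fin_bigcap_measurable => // i _.
  by rewrite -[X in measurable X]setTI; exact: measurable_tnth.
by apply/seteqP; split => x /= h i; [move=> _|]; exact: h.
Qed.

(** The coordinate cylinders that generate the sigma-algebra of tuples are the boxes with all sides
    but one equal to [setT]. *)
Lemma measurable_tuple_box n : measurable =
  <<s [set B | exists2 A : 'I_n -> set X,
                 forall i, measurable (A i) & B = box A] >>.
Proof.
apply/seteqP; split.
  apply: smallest_sub; first exact: smallest_sigma_algebra.
  move=> B; rewrite -bigcup_seq/= => -[i _ [C mC <-]].
  apply: sub_sigma_algebra => /=.
  exists (fun l => if l == i then C else setT).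
    by move=> l; case: ifP.
  apply/seteqP; split => [x /= [_ Cx] l|x /= /(_ i)]; last by rewrite eqxx.
  by case: eqP => [->|].
apply: smallest_sub; first exact: sigma_algebra_measurable.
by move=> _ [A mA ->]; exact: measurable_box.
Qed.

(** Boxes generate the sigma-algebra, are stable under intersection, and include the whole space,
    whose power measure is finite. *)
Lemma power_probability_unique n (nu : {measure set (n.-tuple X) -> \bar R}) :
  (forall A : 'I_n -> set X, (forall i, measurable (A i)) ->
     nu (box A) = (\prod_(i < n) mu (A i))%E) ->
  forall B, measurable B -> nu B = power_probability mu n B.
Proof.
move=> nubox B mB; apply/esym.
apply: (measure_unique _ (fun=> setT) (measurable_tuple_box n)) => //.
- move=> _ _ [A mA ->] [C mC ->]; exists (fun i => A i `&` C i).
    by move=> i; exact: measurableI.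
  apply/seteqP; split => [x [/= h1 h2] i|x /= h]; first by split.
  by split => i; have [] := h i.
- move=> _; exists (fun=> setT) => //.
  by apply/seteqP; split.
- by rewrite bigcup_const.
- move=> _ [A mA ->]; rewrite nubox//; exact: power_probability_box.
- by move=> _; rewrite -ge0_fin_numE// fin_num_measure.
Qed.

Definition subtuple k n (j : 'I_k -> 'I_n) (x : n.-tuple X) : k.-tuple X :=
  [tuple tnth x (j s) | s < k].

Lemma measurable_subtuple k n (j : 'I_k -> 'I_n) :
  measurable_fun [set: n.-tuple X] (subtuple j).
Proof.
apply/measurable_fun_tnthP => s.
rewrite (_ : _ \o _ = fun x => tnth x (j s)); first exact: measurable_tnth.
by apply/funext => x /=; rewrite tnth_mktuple.
Qed.

Lemma power_probability_subtuple k n (j : 'I_k -> 'I_n) (B : set (k.-tuple X)) :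
  injective j -> measurable B ->
  power_probability mu n (subtuple j @^-1` B) = power_probability mu k B.
Proof.
move=> j_inj mB; pose S := isMeasurableFun.Build _ _ _ _ _ (measurable_subtuple j).
pose Y : {mfun _ >-> _} := HB.pack (subtuple j) S.
apply: (power_probability_unique (nu := distribution (power_probability mu n) Y)) => //.
(* The preimage of a box is a box: its side at [j s] is [A s], unambiguous by injectivity, and its
   sides outside the image of [j] are [setT], of measure 1. *)
move=> A mA; rewrite /distribution /pushforward /=.
pose C i := if [pick s | j s == i] is Some s then A s else setT.
have Cj s : C (j s) = A s.
  rewrite /C; case: pickP => [s' /eqP/j_inj -> //|/(_ s)].
  by rewrite eqxx.
transitivity (power_probability mu n [set x | forall i, C i (tnth x i)]).
  congr (power_probability mu n _); apply/seteqP; split => x /= h i; last first.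
    by rewrite tnth_mktuple -Cj.
  rewrite /C; case: pickP => // s /eqP <-.
  by have := h s; rewrite tnth_mktuple.
rewrite power_probability_box; last by move=> i; rewrite /C; case: pickP.
rewrite (bigID (mem (codom j)))/= [X in (_ * X)%E]big1 ?mule1; last first.
  move=> i ij; rewrite /C; case: pickP => [s /eqP jsi|_]; last exact: probability_setT.
  by rewrite -jsi codom_f in ij.
rewrite -big_uniq/=; last by rewrite map_inj_uniq// enum_uniq.
by rewrite big_image/=; apply: eq_bigr => s _; rewrite Cj.
Qed.

Lemma Rintegral_power_subtuple k n (j : 'I_k -> 'I_n) (F : k.-tuple X -> R) :
  injective j -> bounded_measurable F ->
  \int[power_probability mu n]_x F (subtuple j x) =
  \int[power_probability mu k]_x F x.
Proof.
move=> j_inj bF; pose S := isMeasurableFun.Build _ _ _ _ _ (measurable_subtuple j).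
pose Y : {mfun _ >-> _} := HB.pack (subtuple j) S.
have [mF _] := bF.
rewrite /Rintegral; congr fine.
transitivity (\int[distribution (power_probability mu n) Y]_x (F x)%:E)%E; last first.
  by apply: eq_measure_integral => A mA _; exact: power_probability_subtuple.
rewrite integral_distribution//; first exact/measurable_EFinP.
apply: bounded_measurable_integrable.
exact: (bounded_measurable_comp (measurable_subtuple j) bF).
Qed.

End power_probability_law.

(** * Cauchy-Schwarz for products in which each coordinate is shared by at most two factors *)

Section product_integral.
Context d (X : measurableType d) (R : realType) (mu : probability X R).

Lemma Rintegral_le_L2 d' (T : measurableType d') (P : probability T R)
    (f : T -> R) : bounded_measurable f ->
  \int[P]_x f x <= Num.sqrt (\int[P]_x f x ^+ 2).
Proof.
move=> bf; have := Rintegral_cauchy_schwarz P bf (bounded_measurable_cst 1).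
under eq_Rintegral do rewrite mulr1.
by under [X in _ * Num.sqrt X]eq_Rintegral do rewrite expr1n;
  rewrite Rintegral_prob_cst sqrtr1 mulr1.
Qed.

(** A factor outside [D] is constant and nonnegative, hence equal to its own L2 norm, and comes out
    of the integral. At most two factors remain: two call for Cauchy-Schwarz, one for Cauchy-Schwarz
    against 1. *)
Lemma Rintegral_prod_le (I : finType) (A D : {set I}) (h : I -> X -> R) :
  (forall a, bounded_measurable (h a)) -> (forall a x, 0 <= h a x) ->
  (forall a x y, a \notin D -> h a x = h a y) -> (#|A :&: D| <= 2)%N ->
  \int[mu]_x (\prod_(a in A) h a x) <=
  \prod_(a in A) Num.sqrt (\int[mu]_x h a x ^+ 2).
Proof.
move=> bh h0 hD AD2.
pose c a := Num.sqrt (\int[mu]_x h a x ^+ 2).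
have hc a x : a \notin D -> h a x = c a.
  move=> aD; rewrite /c (@eq_Rintegral _ _ _ _ _ (fun=> h a x ^+ 2)).
    by rewrite Rintegral_prob_cst sqrtr_sqr ger0_norm.
  by move=> y _; rewrite (hD a y x).
have c0 a : 0 <= c a by exact: sqrtr_ge0.
have splitA (F : I -> R) : \prod_(a in A) F a =
    \prod_(a in A :&: D) F a * \prod_(a in A :\: D) F a.
  by rewrite (big_setID D).
rewrite [leRHS]splitA -/c.
under eq_Rintegral => x _.
  rewrite splitA [X in _ * X](eq_bigr c); last first.
    by move=> a; rewrite inE => /andP[aD _]; exact: hc.
  over.
rewrite RintegralZr//; last first.
  exact/bounded_measurable_integrable/bounded_measurable_prod.
apply: ler_wpM2r; first exact: prodr_ge0.
move: AD2; rewrite leq_eqVlt => /predU1P[/eqP/cards2P[a [b [ab ->]]]|].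
  under eq_Rintegral do rewrite big_setU1 ?inE//= big_set1.
  by rewrite big_setU1 ?inE//= big_set1; exact: Rintegral_cauchy_schwarz.
rewrite ltnS leq_eqVlt => /predU1P[/eqP/cards1P[a ->]|].
  under eq_Rintegral do rewrite big_set1.
  by rewrite big_set1; exact: Rintegral_le_L2.
rewrite ltnS leqn0 cards_eq0 => /eqP ->.
under eq_Rintegral do rewrite big_set0.
by rewrite big_set0 Rintegral_prob_cst.
Qed.

(** [D i] contains the factors that may depend on coordinate [i]. Integrating out the first
    coordinate replaces each [g a] by [g' a], its L2 norm in that coordinate, a function of the
    other coordinates with the same total L2 norm; induction applies to [g']. *)
Lemma Rintegral_power_prod_le n (I : finType) (A : {set I})
    (D : 'I_n -> {set I}) (g : I -> n.-tuple X -> R) :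
  (forall a, bounded_measurable (g a)) -> (forall a x, 0 <= g a x) ->
  (forall a x y, (forall i, a \in D i -> tnth x i = tnth y i) ->
     g a x = g a y) ->
  (forall i, #|A :&: D i| <= 2)%N ->
  \int[power_probability mu n]_x (\prod_(a in A) g a x) <=
  \prod_(a in A) Num.sqrt (\int[power_probability mu n]_x g a x ^+ 2).
Proof.
elim: n D g => [|n IHn] D g bg g0 gD AD2.
  rewrite Rintegral_power0; last exact: bounded_measurable_prod.
  apply: ler_prod => a _; rewrite g0/= Rintegral_power0 ?sqrtr_sqr ?ler_norm//.
  exact: bounded_measurable_exp.
pose g' a (t : n.-tuple X) := Num.sqrt (\int[mu]_x g a (cons_pair (x, t)) ^+ 2).
have bg2 a : bounded_measurable (fun x => g a x ^+ 2).
  exact: bounded_measurable_exp.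
have bint a : bounded_measurable
    (fun t : n.-tuple X => \int[mu]_x g a (cons_pair (x, t)) ^+ 2).
  (* [bounded_measurable_Rintegral] integrates the second component of a pair, hence the swapped
     order. *)
  pose F (p : n.-tuple X * X) := g a (cons_pair (p.2, p.1)) ^+ 2.
  apply: (@bounded_measurable_Rintegral _ _ _ _ _ (power_probability mu n) mu F).
  apply: (bounded_measurable_comp
    (h := fun p : n.-tuple X * X => cons_pair (p.2, p.1)) _ (bg2 a)).
  exact: (measurable_cons measurable_snd measurable_fst).
have bg' a : bounded_measurable (g' a) by exact: bounded_measurable_sqrt.
rewrite Rintegral_powerSC; last exact: bounded_measurable_prod.
apply: (@le_trans _ _ (\int[power_probability mu n]_t \prod_(a in A) g' a t)).
  apply: le_Rintegral_bounded.
  - pose F (p : n.-tuple X * X) := \prod_(a in A) g a (cons_pair (p.2, p.1)).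
    apply: (@bounded_measurable_Rintegral _ _ _ _ _ (power_probability mu n) mu F).
    apply: bounded_measurable_prod => a; apply: (bounded_measurable_comp
      (h := fun p : n.-tuple X * X => cons_pair (p.2, p.1)) _ (bg a)).
    exact: (measurable_cons measurable_snd measurable_fst).
  - exact: bounded_measurable_prod.
  move=> t; apply: (Rintegral_prod_le (D := D ord0)) => //.
    by move=> a; exact: (bounded_measurable_pair2 (bounded_measurable_cons (bg a)) t).
  move=> a x y aD; apply: gD => i; case: (unliftP ord0 i) => [j ->|-> aD'].
    by rewrite !tnthS.
  by rewrite aD' in aD.
apply: le_trans (IHn (fun i => D (lift ord0 i)) g' bg' _ _ _) _ => //.
- by move=> a x; exact: sqrtr_ge0.
- move=> a x y xy; rewrite /g'; congr Num.sqrt.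
  apply: eq_Rintegral => z _; congr (_ ^+ 2); apply: gD => i.
  by case: (unliftP ord0 i) => [j ->|->]// /xy; rewrite !tnthS.
rewrite le_eqVlt; apply/orP; left; apply/eqP; apply: eq_bigr => a _.
congr Num.sqrt; rewrite [RHS]Rintegral_powerSC//; apply: eq_Rintegral => t _.
by rewrite sqr_sqrtr// Rintegral_ge0// => x _; exact: sqr_ge0.
Qed.

End product_integral.

(** * Combinatorics of the index configurations *)

Lemma exists_subset_card (I : finType) (A : {set I}) (m : nat) :
  (m <= #|A|)%N -> exists2 B : {set I}, B \subset A & #|B| = m.
Proof.
move=> /card_geqP[s [us <- sA]]; exists [set x in s].
  by apply/fintype.subsetP => x; rewrite inE; exact: sA.
by rewrite cardsE; exact/card_uniqP.
Qed.

(** From each [D v] discard [#|D v| - 2] elements (none when [D v] has at most two, the subtraction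
    being truncated), and let [A] be what survives all discards. *)
Lemma exists_sparse_set (V I : finType) (D : V -> {set I}) :
  exists A : {set I}, (forall v, #|A :&: D v| <= 2)%N /\
    (#|I| <= #|A| + \sum_v (#|D v| - 2))%N.
Proof.
have /choice[E ED] v : exists B : {set I}, B \subset D v /\ #|B| = (#|D v| - 2)%N.
  by have [B] := exists_subset_card (leq_subr 2 #|D v|); exists B.
exists (~: \bigcup_v E v); split=> [v|].
  apply: (@leq_trans #|D v :\: E v|).
    apply: subset_leq_card; apply/fintype.subsetP => a; rewrite !inE => /andP[aE ->].
    by rewrite andbT; apply: contra aE => aE; apply/bigcupP; exists v.
  have [/finset.setIidPr EDv cE] := ED v.
  by rewrite cardsD EDv cE; lia.
rewrite -(cardsC (\bigcup_v E v)) addnC leq_add2l.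
apply: (@leq_trans (\sum_v #|E v|)); last first.
  by rewrite leq_eqVlt; apply/orP; left; apply/eqP/eq_bigr => v _; case: (ED v).
elim/big_rec2: _ => [|v m B _ ih]; first by rewrite cards0.
by rewrite (leq_trans (leq_card_setU _ _))// leq_add2l.
Qed.

Section configurations.
Variables k n p : nat.
Implicit Types J : {ffun 'I_p -> {ffun 'I_k -> 'I_n}}.

(** A configuration [J] is a term of the expanded [p]-th power: copy [a] of [f] is evaluated at the
    indices [J a]. *)
Definition users J (v : 'I_n) : {set 'I_p} := [set a | v \in codom (J a)].

Definition used_indices J : {set 'I_n} := [set v | users J v != finset.set0].

Lemma sum_users J : (forall a, injective (J a)) ->
  (\sum_v #|users J v| = k * p)%N.
Proof.
move=> Jinj.
transitivity (\sum_v \sum_a (v \in codom (J a) : nat))%N.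
  by apply: eq_bigr => v _; rewrite -sum1dep_card big_mkcond.
rewrite exchange_big/= -[p in RHS]card_ord mulnC -sum_nat_const.
apply: eq_bigr => a _; rewrite -big_mkcond/= sum1_card.
by rewrite (card_codom (Jinj a)) card_ord.
Qed.

Lemma sum_users_sub2 J : (forall a, injective (J a)) ->
  (forall v, #|users J v| != 1)%N ->
  (\sum_v (#|users J v| - 2) + 2 * #|used_indices J| = k * p)%N.
Proof.
move=> Jinj no1; rewrite -(sum_users Jinj) mulnC -sum_nat_const.
rewrite [X in (_ + X)%N]big_mkcond/= -big_split/=; apply: eq_bigr => v _.
rewrite inE -cards_eq0; move: (no1 v); case: #|_| => [|[|m]]//= _.
by rewrite addn2 subn2.
Qed.

Lemma card_used_indices_eq (V : {set 'I_n}) :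
  (#|[set J | used_indices J == V]| <= #|V| ^ (k * p))%N.
Proof.
apply: (@leq_trans #|(ffun_on (mem (ffun_on (mem V))) :
    {pred {ffun 'I_p -> {ffun 'I_k -> 'I_n}}})|).
  apply: subset_leq_card; apply/fintype.subsetP => J; rewrite inE => /eqP JV.
  apply/ffun_onP => a; apply/ffun_onP => s; rewrite -JV !inE.
  apply/set0Pn; exists a; rewrite inE; exact: codom_f.
by rewrite !card_ffun_on !card_ord expnM.
Qed.

(** Configurations are grouped by their set of used indices, and these sets by their size [r]. *)
Lemma sum_used_indices_le (R : realType) (B : nat -> R) : (forall r, 0 <= B r) ->
  \sum_J B #|used_indices J| <= \sum_(r < n.+1) ('C(n, r) * r ^ (k * p))%:R * B r.
Proof.
move=> B0; rewrite (partition_big used_indices xpredT)//=.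
apply: (@le_trans _ _ (\sum_(V : {set 'I_n}) (#|V| ^ (k * p))%:R * B #|V|)).
  apply: ler_sum => V _; rewrite (eq_bigr (fun=> B #|V|)); last first.
    by move=> J /eqP ->.
  rewrite sumr_const -[leLHS]mulr_natl ler_wpM2r// ler_nat.
  apply: leq_trans (card_used_indices_eq V); apply: subset_leq_card.
  by apply/fintype.subsetP => J; rewrite !inE.
have cV (V : {set 'I_n}) : (#|V| < n.+1)%N.
  by rewrite ltnS -[X in (_ <= X)%N]card_ord max_card.
rewrite (partition_big (fun V => Ordinal (cV V)) xpredT)//=.
apply: ler_sum => r _; rewrite (eq_bigr (fun=> (r ^ (k * p))%:R * B r)); last first.
  by move=> V /eqP <-.
rewrite sumr_const -[leLHS]mulr_natl mulrA -natrM ler_wpM2r// ler_nat leq_mul2r.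
apply/orP; right.
rewrite -[X in 'C(X, _)](card_ord n) -cardsT -(cards_draws [set: 'I_n]%SET).
by apply: subset_leq_card; apply/fintype.subsetP => V /eqP <-; rewrite inE finset.subsetT /=.
Qed.

End configurations.

(** * Moments of the sum over injective index maps *)

Section moment.
Context d (X : measurableType d) (R : realType) (mu : probability X R).
Variables (k n : nat) (f : k.-tuple X -> R).
Hypotheses (mf : measurable_fun [set: k.-tuple X] f)
  (f1 : forall x, `|f x| <= 1) (canf : canonical_fun mu f).
Implicit Types (p : nat) (j : 'I_k -> 'I_n).

Let bf : bounded_measurable f. Proof. by split => //; exists 1. Qed.

Lemma bounded_measurable_subtuple j :
  bounded_measurable (fun x : n.-tuple X => f (subtuple j x)).
Proof. exact: (bounded_measurable_comp (measurable_subtuple j) bf). Qed.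

Lemma subtuple_subst_coord j s (x : n.-tuple X) u : injective j ->
  subtuple j (subst_coord x (j s) u) = subst_coord (subtuple j x) s u.
Proof.
move=> j_inj; apply: eq_from_tnth => i; rewrite !tnth_mktuple.
by rewrite (inj_eq j_inj).
Qed.

Lemma subtuple_subst_coord_notin j v (x : n.-tuple X) u : v \notin codom j ->
  subtuple j (subst_coord x v u) = subtuple j x.
Proof.
move=> vj; apply: eq_from_tnth => i; rewrite !tnth_mktuple.
by case: eqP => // jiv; rewrite -jiv codom_f in vj.
Qed.

(** Only one factor depends on coordinate [v], and it does so through a single argument of [f];
    canonicity kills the integral over that coordinate. *)
Lemma Rintegral_prod_single_user p (J : {ffun 'I_p -> {ffun 'I_k -> 'I_n}}) v :
  (forall a, injective (J a)) -> #|users J v| = 1%N ->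
  \int[power_probability mu n]_x (\prod_a f (subtuple (J a) x)) = 0.
Proof.
move=> Jinj /eqP/cards1P[a Jva].
have /codomP[s vE] : v \in codom (J a).
  have : a \in users J v by rewrite Jva finset.set11.
  by rewrite inE.
have Jb b : b != a -> v \notin codom (J b).
  move=> ba; have : b \notin users J v by rewrite Jva finset.in_set1.
  by rewrite inE.
apply: (Rintegral_power_eq0 (v := v)).
  by apply: bounded_measurable_prod => a'; exact: bounded_measurable_subtuple.
move=> x; rewrite (@eq_Rintegral _ _ _ _ _ (fun u =>
    f (subst_coord (subtuple (J a) x) s u) *
    \prod_(b | b != a) f (subtuple (J b) x))); last first.
  move=> u _; rewrite (bigD1 a)//= {1}vE subtuple_subst_coord//; congr (_ * _).
  by apply: eq_bigr => b ba; rewrite subtuple_subst_coord_notin// Jb.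
rewrite RintegralZr//.
  by rewrite /Rintegral canf mul0r.
apply: bounded_measurable_integrable.
apply: (bounded_measurable_comp (h := subst_coord (subtuple (J a) x) s) _ bf).
apply/measurable_fun_tnthP => i.
rewrite (_ : _ \o _ = fun u => if i == s then u else tnth (subtuple (J a) x) i).
  by case: (i == s).
by apply/funext => u /=; rewrite tnth_mktuple.
Qed.

Let c := Num.sqrt (\int[power_probability mu k]_x f x ^+ 2).

Lemma L2_le1 : 0 <= c <= 1.
Proof.
rewrite sqrtr_ge0 -[leRHS]sqrtr1 ler_wsqrtr//.
rewrite -[leRHS](Rintegral_prob_cst (power_probability mu k)).
apply: le_Rintegral_bounded => [||x].
- exact: bounded_measurable_exp.
- exact: bounded_measurable_cst.
- by rewrite -real_normK ?num_real// expr_le1.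
Qed.

Lemma Rintegral_prod_users_le p (J : {ffun 'I_p -> {ffun 'I_k -> 'I_n}}) :
  (forall a, injective (J a)) -> (forall v, #|users J v| != 1)%N ->
  `|\int[power_probability mu n]_x (\prod_a f (subtuple (J a) x))| <=
  c ^+ (p - (k * p - 2 * #|used_indices J|)).
Proof.
move=> Jinj no1; have [A [A2 cA]] := exists_sparse_set (users J).
have /andP[c0 c1] := L2_le1.
(* As [c <= 1], a lower bound on the number of kept copies suffices. *)
apply: (@le_trans _ _ (c ^+ #|A|)); last first.
  apply: ler_wiXn2l => //; move: cA (sum_users_sub2 Jinj no1).
  by rewrite card_ord; lia.
have bprod : bounded_measurable
    (fun x : n.-tuple X => \prod_a f (subtuple (J a) x)).
  by apply: bounded_measurable_prod => a; exact: bounded_measurable_subtuple.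
apply: (le_trans (le_normr_Rintegral _ _)) => //.
  exact: bounded_measurable_integrable.
pose g a (x : n.-tuple X) := `|f (subtuple (J a) x)|.
have bg a : bounded_measurable (g a).
  exact/bounded_measurable_norm/bounded_measurable_subtuple.
apply: (@le_trans _ _ (\int[power_probability mu n]_x \prod_(a in A) g a x)).
  apply: le_Rintegral_bounded => [||x].
  - exact: bounded_measurable_norm.
  - exact: bounded_measurable_prod.
  rewrite normr_prod (bigID (mem A))/= ler_piMr ?prodr_ge0//.
  by apply: prodr_ile1 => a _; rewrite normr_ge0 f1.
apply: le_trans (Rintegral_power_prod_le mu (D := users J) _ _ _ _) _ => //.
- by move=> a x; exact: normr_ge0.
- move=> a x y xy; rewrite /g; congr (`|f _|); apply: eq_from_tnth => s.
  by rewrite !tnth_mktuple xy// inE codom_f.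
(* [J a] being injective, its subtuple has law [mu^k], so every kept factor has L2 norm [c]. *)
rewrite (eq_bigr (fun=> c)) ?prodr_const// => a _.
rewrite /c; congr Num.sqrt.
rewrite -(Rintegral_power_subtuple mu (Jinj a) (bounded_measurable_exp 2 bf)).
by apply: eq_Rintegral => x _; rewrite /g real_normK ?num_real.
Qed.

Definition injective_sum (x : n.-tuple X) : R :=
  \sum_(j : {ffun 'I_k -> 'I_n} | injectiveb j) f (subtuple j x).

Lemma bounded_measurable_injective_sum : bounded_measurable injective_sum.
Proof.
by apply: bounded_measurable_sum => j; exact: bounded_measurable_subtuple.
Qed.

(** If [2r > kp], some index has exactly one user and the term vanishes. The [if] records this,
    which the exponent, with its truncated subtractions, would not. *)
Lemma injective_sum_moment_le p :
  \int[power_probability mu n]_x injective_sum x ^+ p <=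
  \sum_(r < n.+1) ('C(n, r) * r ^ (k * p))%:R *
    (if (2 * r <= k * p)%N then c ^+ (p - (k * p - 2 * r)) else 0).
Proof.
have /andP[c0 c1] := L2_le1.
have expand x : injective_sum x ^+ p =
  \sum_(J : {ffun 'I_p -> {ffun 'I_k -> 'I_n}} | J \in ffun_on
    (fun j : {ffun 'I_k -> 'I_n} => injectiveb j)) \prod_a f (subtuple (J a) x).
  rewrite -[p in LHS]card_ord -prodr_const.
  by rewrite bigA_distr_big.
under eq_Rintegral do rewrite expand.
rewrite Rintegral_sum_bounded; last first.
  move=> J; apply: bounded_measurable_prod => a.
  exact: bounded_measurable_subtuple.
pose B r : R := if (2 * r <= k * p)%N then c ^+ (p - (k * p - 2 * r)) else 0.
have B0 r : 0 <= B r by rewrite /B; case: ifP => // _; exact: exprn_ge0.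
apply: le_trans (sum_used_indices_le k n p B0).
rewrite [leLHS]big_mkcond/=; apply: ler_sum => J _.
case: ifP => // /ffun_onP Jinj.
have {}Jinj a : injective (J a) by apply/injectiveP; exact: Jinj.
have [/existsP[v /eqP]|/existsPn no1] := boolP [exists v, #|users J v| == 1%N].
  by move=> /(Rintegral_prod_single_user Jinj) ->.
apply: le_trans (ler_norm _) _.
apply: le_trans (Rintegral_prod_users_le Jinj no1) _.
by rewrite /B ifT// -(sum_users_sub2 Jinj no1) leq_addl.
Qed.

End moment.

(** * Estimates for the counting factors and the moment sum *)

Lemma bin_le_exp2 n m : ('C(n, m) <= 2 ^ n)%N.
Proof.
elim: n m => [|n IHn] [|m]//; first by rewrite bin0 expn_gt0.
by rewrite binS expnS mul2n -addnn leq_add.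
Qed.

Lemma ffact_le_exp n m : (n ^_ m <= n ^ m)%N.
Proof. by elim: m => // m IHm; rewrite ffactnSr expnSr leq_mul// leq_subr. Qed.

Lemma exp_le_ffact r m : (r ^ m <= (r + m) ^_ m)%N.
Proof.
elim: m => // m IHm; rewrite addnS ffactSS expnS leq_mul//.
by rewrite (leq_trans (leq_addr m r)).
Qed.

(** A weak Stirling bound: [r ^ r] is at most the falling factorial [(2r) ^_ r], which is [r!] times
    a central binomial coefficient. *)
Lemma exp_self_le_fact r : (r ^ r <= 4 ^ r * r`!)%N.
Proof.
apply: leq_trans (exp_le_ffact r r) _.
rewrite -bin_ffact leq_mul2r addnn -mul2n (_ : 4 = 2 ^ 2)%N// -expnM.
by rewrite bin_le_exp2 orbT.
Qed.

(** With [N = kM], split [r^(2N)] as [r^r r^(2N-r)]. The first factor is absorbed by the binomial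
    coefficient, ['C(n, r) r^r <= 4^r n^r]; in the second, [r <= kM]. *)
Lemma bin_mul_exp_le n r k M : (0 < k)%N -> (r <= k * M)%N ->
  ('C(n, r) * r ^ (2 * (k * M)) <=
   (4 * k ^ 2) ^ (k * M) * n ^ r * M ^ (2 * (k * M) - r))%N.
Proof.
move=> k0; set N := (k * M)%N => rN.
have {1}-> : (2 * N = r + (2 * N - r))%N by lia.
have le_base a b e : (a <= b -> a ^ e <= b ^ e)%N.
  by case: e => // e ab; rewrite leq_exp2r.
rewrite expnD mulnA.
apply: (@leq_trans (4 ^ N * n ^ r * (k ^ (2 * N) * M ^ (2 * N - r)))).
  apply: leq_mul.
    apply: (@leq_trans ('C(n, r) * (4 ^ r * r`!))).
      by rewrite leq_mul// exp_self_le_fact.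
    by rewrite mulnCA bin_ffact leq_mul ?ffact_le_exp// leq_pexp2l.
  apply: leq_trans (le_base _ _ _ rN) _.
  by rewrite /N expnMn leq_mul// leq_pexp2l// leq_subr.
by rewrite expnMn expnM; lia.
Qed.

Section moment_bound.
Context (R : realType).

(** Here [e] stands for [N - r]. Factoring out [n^N M^N] leaves [(M/n)^e c2^(M-e) <= q^(e + (M-e))];
    for [e > M] the truncated exponent exceeds [M], which is harmless since [q <= 1]. *)
Lemma moment_term_le (n M N e : nat) (c2 q : R) :
  (0 < n)%N -> (e <= N)%N -> 0 <= c2 <= q -> (M%:R / n%:R) <= q -> q <= 1 ->
  (n ^ (N - e) * M ^ (N + e))%:R * c2 ^+ (M - e) <= n%:R ^+ N * M%:R ^+ N * q ^+ M.
Proof.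
move=> n0 eN /andP[c0 cq] Mq q1.
have nn0 : n%:R != 0 :> R by rewrite pnatr_eq0 -lt0n.
have q0 : 0 <= q by exact: le_trans cq.
rewrite (_ : (_ * _)%:R = n%:R ^+ N * M%:R ^+ N * (M%:R / n%:R) ^+ e); last first.
  rewrite -{2 3 4}(subnK eN) natrM !natrX !exprD expr_div_n.
  by field; rewrite expf_neq0.
rewrite -[leLHS]mulrA.
rewrite ler_wpM2l ?mulr_ge0 ?exprn_ge0//.
apply: (@le_trans _ _ (q ^+ e * q ^+ (M - e))).
  by rewrite ler_pM ?exprn_ge0 ?divr_ge0// lerXn2r// ?nnegrE ?divr_ge0.
rewrite -exprD; apply: ler_wiXn2l => //.
lia.
Qed.

Lemma sum_moment_terms_le (n k M : nat) (c : R) :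
  (0 < n)%N -> (0 < k)%N -> (0 < M)%N -> (2 * M <= n)%N -> 0 <= c <= 1 ->
  \sum_(r < n.+1) ('C(n, r) * r ^ (k * (2 * M)))%:R *
    (if (2 * r <= k * (2 * M))%N
     then c ^+ (2 * M - (k * (2 * M) - 2 * r)) else 0) <=
  n%:R ^+ (k * M) *
    (((8 * k ^ 2) ^ k)%:R * M%:R ^+ k * Num.max (M%:R / n%:R) (c ^+ 2)) ^+ M.
Proof.
move=> n0 k0 M0 Mn /andP[c0 c1]; set q := Num.max _ _; set N := (k * M)%N.
have q0 : 0 <= q by rewrite le_max sqr_ge0 orbT.
have q1 : q <= 1.
  rewrite ge_max expr_le1// c1 andbT ler_pdivrMr ?ltr0n// mul1r ler_nat; lia.
pose B : R := ((4 * k ^ 2) ^ N)%:R * (n%:R ^+ N * M%:R ^+ N * q ^+ M).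
have B0 : 0 <= B by rewrite !mulr_ge0 ?exprn_ge0.
(* Every nonzero term is at most [B], and there are at most [N + 1 <= 2^N] of them; this factor
   turns [4 k^2] into [8 k^2]. *)
apply: (@le_trans _ _ (\sum_(r < n.+1 | (r <= N)%N) B)).
  rewrite [leRHS]big_mkcond/=; apply: ler_sum => r _.
  have -> : (2 * r <= k * (2 * M))%N = (r <= N)%N by rewrite /N; lia.
  case: ifP => rN; last by rewrite mulr0.
  have -> : (2 * M - (k * (2 * M) - 2 * r) = 2 * (M - (N - r)))%N by rewrite /N; lia.
  rewrite exprM.
  apply: (@le_trans _ _ (((4 * k ^ 2) ^ N)%:R *
      ((n ^ (N - (N - r)) * M ^ (N + (N - r)))%:R * (c ^+ 2) ^+ (M - (N - r))))).
    rewrite [leRHS]mulrA -[X in _ <= X * _]natrM.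
    apply: ler_wpM2r; first by rewrite exprn_ge0 ?sqr_ge0.
    rewrite ler_nat.
    have := bin_mul_exp_le n k0 rN; rewrite -/N.
    rewrite (_ : k * (2 * M) = 2 * N)%N; last by rewrite /N; lia.
    rewrite (_ : N + (N - r) = 2 * N - r)%N; last by lia.
    by rewrite subKn// mulnA.
  rewrite ler_wpM2l//; apply: moment_term_le => //.
  - exact: leq_subr.
  - by rewrite sqr_ge0 le_max lexx orbT.
  - by rewrite le_max lexx.
rewrite sumr_const.
have card_le : (#|[pred r : 'I_n.+1 | (r <= N)%N]| <= 2 ^ N)%N.
  apply: (@leq_trans N.+1); last exact: ltn_expl.
  rewrite -[X in (_ <= X)%N](card_ord N.+1).
  apply: (@leq_card_in _ _ (fun r : 'I_n.+1 => inord r)) => r s.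
  rewrite !inE => rN sN /(congr1 val); rewrite /= !inordK//.
  exact: val_inj.
apply: (@le_trans _ _ ((2 ^ N)%:R * B)).
  by rewrite -[leLHS]mulr_natl ler_wpM2r// ler_nat.
have E8 : ((8 * k ^ 2) ^ k)%:R ^+ M = (2 ^ N)%:R * ((4 * k ^ 2) ^ N)%:R :> R.
  by rewrite -natrX -expnM -/N -natrM -expnMn mulnA.
rewrite !exprMn E8 -exprM -/N /B le_eqVlt; apply/orP; left; apply/eqP.
ring.
Qed.

End moment_bound.

(** * Choice of the moment *)

Section tail.
Context (R : realType).

Lemma powR_root_exp (a : R) (b m : nat) : 0 <= a -> (0 < m)%N ->
  (a `^ (b%:R / m%:R)) ^+ m = a ^+ b.
Proof.
move=> a0 m0; rewrite -powR_mulrn ?powR_ge0// -powRrM divfK ?powR_mulrn//.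
by rewrite pnatr_eq0 -lt0n.
Qed.

(** Here [p] is the tail probability and [L] the smaller of the exponents [u], [v]. With [M] the
    integer part of [L], the [M]-th bound is at most [exp(-M) <= exp(1 - L)]; the factor [expR 1]
    pays for the rounding. *)
Lemma tail_of_moments (n k : nat) (A p x s : R) :
  (0 < n)%N -> (0 < k)%N -> 1 <= A -> 0 < x -> 0 < s -> 0 <= p <= 1 ->
  (forall M, (0 < M)%N ->
     p <= (A * M%:R ^+ k * Num.max (M%:R / n%:R) (s ^+ 2) / x ^+ 2) ^+ M) ->
  p <= expR 1 * Num.max
    (expR (- ((expR 1 * A)^-1 * (x / s) `^ (2 / k%:R))))
    (expR (- ((expR 1 * A)^-1 * (n%:R * x ^+ 2) `^ (k.+1%:R^-1)))).
Proof.
move=> n0 k0 A1 x0 s0 /andP[p0 p1] hp.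
have A0 : 0 < A by exact: lt_le_trans A1.
have e1 : 1 <= expR 1 :> R by rewrite -[leLHS]expR0 ler_expR.
have e0 : 0 < expR 1 :> R by exact: expR_gt0.
set al := (expR 1 * A)^-1.
have al0 : 0 < al by rewrite invr_gt0 mulr_gt0.
have al1 : al <= 1 by rewrite invf_le1 ?mulr_gt0// mulr_ege1.
have nn0 : 0 < n%:R :> R by rewrite ltr0n.
have [xge0 sge0 Age0 alge0] : [/\ 0 <= x, 0 <= s, 0 <= A & 0 <= al].
  by split; exact: ltW.
set u := al * _; set v := al * _.
have u0 : 0 <= u by rewrite mulr_ge0 ?powR_ge0.
have v0 : 0 <= v by rewrite mulr_ge0 ?powR_ge0.
(* As [al <= 1], its powers are bounded by [al] itself. *)
have uk : u ^+ k <= al * (x / s) ^+ 2.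
  rewrite exprMn powR_root_exp ?divr_ge0//.
  apply: ler_wpM2r; first exact: sqr_ge0.
  by rewrite -[leRHS]expr1 ler_wiXn2l.
have vk : v ^+ k.+1 <= al * (n%:R * x ^+ 2).
  rewrite exprMn -(div1r k.+1%:R) (powR_root_exp 1) ?mulr_ge0 ?sqr_ge0//.
  rewrite expr1; apply: ler_wpM2r; first by rewrite mulr_ge0 ?sqr_ge0.
  by rewrite -[leRHS]expr1 ler_wiXn2l.
set L := Num.min u v.
apply: (@le_trans _ _ (expR 1 * expR (- L))); last first.
  rewrite ler_wpM2l ?expR_ge0// le_max /L.
  by case: (leP u v) => _; rewrite lexx ?orbT.
rewrite -expRD.
(* For [L < 1] the integer part is 0, but then the claimed bound exceeds 1. *)
have [L1|L1] := ltP L 1.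
  by apply: le_trans p1 _; rewrite -[leLHS]expR0 ler_expR subr_ge0 ltW.
have L0 : 0 <= L by exact: le_trans L1.
have /andP[ML LM] := truncn_itv L0; set M := Num.truncn L in ML LM.
have M0 : (0 < M)%N.
  by rewrite -(ltr0n R) -(ltrD2r 1) add0r natr1 (le_lt_trans L1).
have Mu : M%:R <= u by rewrite (le_trans ML)// ge_min lexx.
have Mv : M%:R <= v by rewrite (le_trans ML)// ge_min lexx orbT.
apply: le_trans (hp M M0) _.
apply: (@le_trans _ _ (expR (- 1) ^+ M)); last first.
  rewrite -expRM_natl ler_expR mulrN1.
  by move: LM; rewrite -natr1; lra.
have q0 : 0 <= Num.max (M%:R / n%:R) (s ^+ 2) by rewrite le_max sqr_ge0 orbT.
apply: lerXn2r; rewrite ?nnegrE ?expR_ge0 ?divr_ge0 ?mulr_ge0 ?exprn_ge0//.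
rewrite ler_pdivrMr ?exprn_gt0// expRN.
(* The branch [M/n] is controlled by [v], the branch [s^2] by [u]; in both, [al = 1/(eA)] leaves
   exactly [x^2/e]. *)
rewrite maxr_pMr ?mulr_ge0 ?exprn_ge0// ge_max; apply/andP; split.
  have : M%:R ^+ k.+1 <= al * (n%:R * x ^+ 2).
    by apply: le_trans vk; rewrite lerXn2r ?nnegrE.
  rewrite exprSr /al => h; rewrite !mulrA ler_pdivrMr// -[leLHS]mulrA.
  apply: le_trans (ler_wpM2l (ltW A0) h) _ => //.
  rewrite le_eqVlt; apply/orP; left; apply/eqP.
  by field; rewrite !gt_eqF.
have : M%:R ^+ k <= al * (x / s) ^+ 2.
  by apply: le_trans uk; rewrite lerXn2r ?nnegrE.
rewrite /al => h; apply: le_trans (ler_wpM2r (sqr_ge0 s) (ler_wpM2l (ltW A0) h)) _.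
rewrite le_eqVlt; apply/orP; left; apply/eqP.
by field; rewrite !gt_eqF.
Qed.

End tail.

(** * The even moment bound for every [M], and Markov's inequality *)

Section even_moment.
Context d (X : measurableType d) (R : realType) (mu : probability X R).
Variables (k n : nat) (f : k.-tuple X -> R).
Hypotheses (mf : measurable_fun [set: k.-tuple X] f)
  (f1 : forall x, `|f x| <= 1) (canf : canonical_fun mu f)
  (k0 : (0 < k)%N) (n0 : (0 < n)%N).

Let T : n.-tuple X -> R := injective_sum (n := n) f.

Lemma injective_sum_le x : `|T x| <= n%:R ^+ k.
Proof.
apply: le_trans (ler_norm_sum _ _ _) _.
rewrite big_mkcond/=; apply: (@le_trans _ _ (\sum_(j : {ffun 'I_k -> 'I_n}) 1)).
  by apply: ler_sum => j _; case: ifP.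
by rewrite sumr_const card_ffun !card_ord -natrX.
Qed.

Lemma injective_sum_even_moment_le M : (0 < M)%N ->
  \int[power_probability mu n]_x T x ^+ (2 * M) <=
  n%:R ^+ (k * M) * (((8 * k ^ 2) ^ k)%:R * M%:R ^+ k *
    Num.max (M%:R / n%:R) (\int[power_probability mu k]_x f x ^+ 2)) ^+ M.
Proof.
move=> M0; set s2 := \int[_]_x f x ^+ 2.
have s20 : 0 <= s2 by apply: Rintegral_ge0 => x _; exact: sqr_ge0.
have [Mn|nM] := leqP (2 * M) n.
  have := sum_moment_terms_le n0 k0 M0 Mn (L2_le1 mu mf f1).
  rewrite sqr_sqrtr//; apply: le_trans.
  exact: (injective_sum_moment_le n mf f1 canf (2 * M)).
(* For [2M > n] the trivial bound [|T| <= n^k] is enough: [n^(k+1) <= (2M)^(k+1)] and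
   [2^(k+1) <= 8^k]. *)
apply: (@le_trans _ _ ((n%:R ^+ k) ^+ (2 * M))).
  rewrite -[leRHS](Rintegral_prob_cst (power_probability mu n)).
  apply: le_Rintegral_bounded => [||x].
  - exact/bounded_measurable_exp/bounded_measurable_injective_sum.
  - exact: bounded_measurable_cst.
  rewrite !exprM -[T x ^+ 2]real_normK ?num_real//.
  by rewrite !lerXn2r ?nnegrE ?exprn_ge0 ?injective_sum_le.
have nn0 : 0 < n%:R :> R by rewrite ltr0n.
rewrite mulnC exprM -!exprM [X in _ <= X * _]exprM.
rewrite [leLHS](_ : _ = (n%:R ^+ k) ^+ M * (n%:R ^+ k) ^+ M); last first.
  by rewrite -!exprM -exprD; congr (_ ^+ _); lia.
apply: ler_wpM2l; first by rewrite !exprn_ge0.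
have q0 : 0 <= Num.max (M%:R / n%:R) s2 by rewrite le_max s20 orbT.
apply: lerXn2r; rewrite ?nnegrE ?mulr_ge0 ?exprn_ge0//.
apply: (@le_trans _ _ (((8 * k ^ 2) ^ k)%:R * M%:R ^+ k * (M%:R / n%:R))); last first.
  by apply: ler_wpM2l; rewrite ?mulr_ge0 ?exprn_ge0// le_max lexx.
rewrite mulrA ler_pdivlMr// -exprSr -mulrA -exprSr -!natrX -natrM ler_nat.
apply: (@leq_trans ((2 * M) ^ k.+1)).
  by rewrite leq_exp2r// ltnW.
rewrite expnMn leq_mul2r; apply/orP; right.
apply: (@leq_trans (8 ^ k)).
  by rewrite (_ : 8 = 2 ^ 3)%N// -expnM leq_pexp2l//; lia.
by rewrite leq_exp2r// leq_pmulr// expn_gt0 k0.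
Qed.

(** Integrate [z 1_Q <= T^(2M)] with [z = (x^2 n^k)^M]; the factor [n^(kM)] of the moment bound
    cancels. Squares in the hypothesis on [Q] avoid the power [k/2] of [n]. *)
Lemma injective_sum_markov (Q : set (n.-tuple X)) (x : R) M :
  measurable Q -> 0 < x ->
  (forall t, Q t -> x ^+ 2 * n%:R ^+ k <= T t ^+ 2) -> (0 < M)%N ->
  fine (power_probability mu n Q) <=
  (((8 * k ^ 2) ^ k)%:R * M%:R ^+ k *
    Num.max (M%:R / n%:R) (\int[power_probability mu k]_x f x ^+ 2) / x ^+ 2) ^+ M.
Proof.
move=> mQ x0 QT M0.
have nn0 : 0 < n%:R :> R by rewrite ltr0n.
set z := (x ^+ 2 * n%:R ^+ k) ^+ M.
have z0 : 0 < z by rewrite !(exprn_gt0, mulr_gt0).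
have bQ : bounded_measurable (\1_Q : n.-tuple X -> R).
  split; first exact: measurable_indic.
  by exists 1 => t; rewrite indicE; case: (t \in Q); rewrite ?normr1 ?normr0.
have le_z : z * fine (power_probability mu n Q) <=
    \int[power_probability mu n]_x T x ^+ (2 * M).
  rewrite (_ : fine _ = \int[power_probability mu n]_x \1_Q x); last first.
    by rewrite /Rintegral integral_indic// setIT.
  rewrite -RintegralZl//; last exact: bounded_measurable_integrable.
  apply: le_Rintegral_bounded => [||t].
  - exact: bounded_measurableZ.
  - exact/bounded_measurable_exp/bounded_measurable_injective_sum.
  rewrite indicE exprM; have [tQ|tQ] := boolP (t \in Q).
    rewrite mulr1 lerXn2r ?nnegrE ?sqr_ge0 ?mulr_ge0 ?exprn_ge0 ?(ltW x0)//.
    by apply: QT; rewrite inE in tQ.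
  by rewrite mulr0 exprn_ge0 ?sqr_ge0.
rewrite -(ler_pM2l z0); apply: le_trans le_z _.
apply: le_trans (injective_sum_even_moment_le M0) _.
rewrite le_eqVlt; apply/orP; left; apply/eqP.
rewrite /z exprM -!exprMn; congr (_ ^+ M); field.
by rewrite gt_eqF.
Qed.

End even_moment.

(** * From the moment bound to the [U]-statistic *)

Theorem theorem2 (R : realType) (k : nat) (hk : (1 <= k)%N) :
  exists C alpha : R, [/\ 0 < C, 0 < alpha &
    forall (d d' : measure_display) (X : measurableType d)
      (Omega : measurableType d') (mu : probability X R)
      (P : probability Omega R) (n : nat) (xi : 'I_n -> {RV P >-> X})
      (f : k.-tuple X -> R) (sigma : R),
      (1 <= n)%N ->
      mutually_independent xi ->
      (forall (i : 'I_n) (A : set X),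
         measurable A -> distribution P (xi i) A = mu A) ->
      measurable_fun [set: k.-tuple X] f ->
      canonical_fun mu f ->
      (sup_norm f <= 1)%E ->
      0 < sigma ->
      (\int[power_probability mu k]_x (f x ^+ 2)%:E <= (sigma ^+ 2)%:E)%E ->
      forall x : R, 0 < x ->
        (P [set w | (n%:R `^ (- (k%:R / 2)) *
                     `|U_statistic f (fun i => xi i w)| > x)%R] <=
         (C * Num.max
                (expR (- (alpha * (x / sigma) `^ (2 / k%:R))))
                (expR (- (alpha * (n%:R * x ^+ 2) `^ (k.+1%:R^-1)))))%:E)%E].
Proof.
pose A : R := ((8 * k ^ 2) ^ k)%:R.
have A1 : 1 <= A by rewrite ler1n expn_gt0 muln_gt0 expn_gt0 hk.
have A0 : 0 < A by exact: lt_le_trans A1.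
exists (expR 1), (expR 1 * A)^-1; split; first exact: expR_gt0.
  by rewrite invr_gt0 mulr_gt0 ?expR_gt0.
move=> d d' X Omega mu P n xi f sigma n0 indep law mf canf supf sig0 L2f x x0.
have f1 t : `|f t| <= 1.
  rewrite -lee_fin; apply: le_trans supf; apply: ereal_sup_ubound.
  by exists t.
have bf2 : bounded_measurable (fun t => f t ^+ 2).
  by apply: bounded_measurable_exp; split => //; exists 1.
have {}L2f : \int[power_probability mu k]_x f x ^+ 2 <= sigma ^+ 2.
  by rewrite -lee_fin bounded_measurable_EFin.
pose Y w : n.-tuple X := [tuple xi i w | i < n].
have mY : measurable_fun [set: Omega] Y.
  apply/measurable_fun_tnthP => i.
  rewrite (_ : _ \o _ = xi i); first exact: measurable_funPT.
  by apply/funext => w /=; rewrite tnth_mktuple.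
pose S := isMeasurableFun.Build _ _ _ _ _ mY.
pose Ym : {mfun _ >-> _} := HB.pack Y S.
(* Independence, applied to the full index set, and the common law [mu] identify the joint law on
   boxes, hence everywhere. *)
have lawY B : measurable B -> P (Y @^-1` B) = power_probability mu n B.
  apply: (power_probability_unique (nu := distribution P Ym)) => E mE.
  rewrite (_ : \prod_(i < n) mu (E i) = \prod_(i in [set: 'I_n]%SET) P (xi i @^-1` E i))%E.
    rewrite -indep//; congr (P _); apply/seteqP; split => w /= h i.
      by move=> _; have := h i; rewrite tnth_mktuple.
    by rewrite tnth_mktuple; apply: h; rewrite /= finset.in_setT.
  apply: eq_big => [i|i _]; first by rewrite finset.in_setT.
  exact: (esym (law i _ (mE i))).
pose Tn := injective_sum (n := n) f.
pose W t := n%:R `^ (- (k%:R / 2)) * `|(k`!%:R)^-1 * Tn t|.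
have [mT _] : bounded_measurable Tn by exact: bounded_measurable_injective_sum.
have mW : measurable_fun [set: n.-tuple X] W.
  apply: measurable_funM => //; apply: measurableT_comp => //.
  exact: measurable_funM.
pose Q := [set t | x < W t].
have UE w : U_statistic f (fun i => xi i w) = (k`!%:R)^-1 * Tn (Y w).
  congr (_ * _); apply: eq_bigr => j _; congr f.
  by apply: eq_from_tnth => s; rewrite !tnth_mktuple.
have mQ : measurable Q.
  rewrite -[Q]setTI (_ : Q = W @^-1` `]x, +oo[%classic); first exact: mW.
  by apply/seteqP; split => t /=; rewrite in_itv/= andbT.
rewrite (_ : [set w | _] = Y @^-1` Q); last first.
  by apply/seteqP; split => w; rewrite /Q /W /= UE.
rewrite lawY// -(@fineK _ (power_probability mu n Q)) ?fin_num_measure// lee_fin.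
have nn0 : 0 < n%:R :> R by rewrite ltr0n.
have QT t : Q t -> x ^+ 2 * n%:R ^+ k <= Tn t ^+ 2.
  rewrite /Q /W /= => xW; rewrite -[Tn t ^+ 2]real_normK ?num_real//.
  have nk0 : 0 < n%:R `^ (k%:R / 2) :> R by exact: powR_gt0.
  have -> : n%:R ^+ k = (n%:R `^ (k%:R / 2)) ^+ 2 :> R.
    by rewrite powR_root_exp// ltW.
  rewrite -exprMn lerXn2r ?nnegrE ?mulr_ge0 ?(ltW x0) ?(ltW nk0)//.
  rewrite -ler_pdivlMr// -powRN mulrC; apply: le_trans (ltW xW) _.
  rewrite ler_wpM2l ?powR_ge0// normrM ler_piMl// normfV invf_le1 ?normr_gt0.
    by rewrite ger0_norm// ler1n fact_gt0.
  by rewrite pnatr_eq0 -lt0n fact_gt0.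
apply: tail_of_moments => //.
  rewrite fine_ge0//= -lee_fin fineK ?fin_num_measure//.
  exact: probability_le1.
(* The bound is monotone in the squared L2 norm, which may thus be replaced by [sigma^2]. *)
move=> M M0; apply: le_trans (injective_sum_markov mf f1 canf hk n0 mQ x0 QT M0) _.
apply: lerXn2r; rewrite ?nnegrE ?divr_ge0 ?mulr_ge0 ?exprn_ge0 ?(ltW A0) ?(ltW x0)//.
- by rewrite le_max divr_ge0.
- by rewrite le_max divr_ge0.
rewrite ler_wpM2r ?invr_ge0 ?exprn_ge0 ?(ltW x0)// ler_wpM2l ?mulr_ge0 ?exprn_ge0//.
by rewrite ge_max !le_max lexx L2f orbT.
Qed.
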